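(* Let $d\ge2$ and let $w$ be a weight on $\mathbb{S}^{d-1}$ with $w(\mathbb{S}^{d-1})=1$ such that $w(B)>0$ for every nonempty spherical cap $B\subset\mathbb{S}^{d-1}$. Then there is a constant $C_w>0$, depending only on $d$ and $w$, such that whenever $r\in(0,\pi]$ and $N$ is a positive integer satisfying $\min_{x\in\mathbb{S}^{d-1}}w(B(x,r))\ge\frac1N$, there exists a partition $\{R_1,\dots,R_N\}$ of $\mathbb{S}^{d-1}$ such that $w(R_j)=\frac1N$ and $\operatorname{diam}(R_j)\le C_w r$ for $j=1,\dots,N$.
   Context: $\mathbb{S}^{d-1}=\{x\in\mathbb{R}^d:\|x\|=1\}$ carries the surface Lebesgue measure $d\sigma_d$ and geodesic distance $\mathtt{d}(x,y)=\arccos(x\cdot y)$; $B(x,r)=\{y\in\mathbb{S}^{d-1}:\mathtt{d}(x,y)\le r\}$ is the spherical cap with center $x$ and radius $r>0$. A weight is a nonnegative integrable function $w$ on $\mathbb{S}^{d-1}$, and $w(E)=\int_E w\,d\sigma_d$. Partition here means a finite collection of pairwise disjoint measurable sets whose union is $\mathbb{S}^{d-1}$ (no convexity is required). *)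

(* Defs.v *)
From HB Require Import structures.
From mathcomp Require Import all_boot all_order all_algebra.
From mathcomp Require Import all_classical all_reals all_analysis.

Set Implicit Arguments.
Unset Strict Implicit.
Unset Printing Implicit Defensive.
Import Order.TTheory GRing.Theory Num.Theory.
Import numFieldNormedType.Exports.

Local Open Scope classical_set_scope.
Local Open Scope ring_scope.

Section euclidean.
Context {R : realType} {d : nat}.
Implicit Types x y : 'rV[R]_d.

Definition dotp x y : R := \sum_(i < d) x 0 i * y 0 i.

(* The library norm on 'rV[R]_d is the sup norm. *)
Definition enorm x : R := Num.sqrt (dotp x x).

Definition sphere : set 'rV[R]_d := [set x | enorm x = 1].

Definition geodist x y : R := acos (dotp x y).

Definition cap x (r : R) : set 'rV[R]_d :=
  [set y | sphere y /\ geodist x y <= r].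

Definition geodiam (E : set 'rV[R]_d) : \bar R :=
  ereal_sup [set (geodist p.1 p.2)%:E | p in E `*` E].

End euclidean.

Section surface_measure.
Local Open Scope ereal_scope.
Context {R : realType} {d : nat}.

Definition box (p : 'rV[R]_d * 'rV[R]_d) : set 'rV[R]_d :=
  [set x | forall i, (p.1 0 i <= x 0 i <= p.2 0 i)%R].

Definition box_volume (p : 'rV[R]_d * 'rV[R]_d) : R :=
  \prod_(i < d) (p.2 0 i - p.1 0 i)%R.

Definition box_cover (E : set 'rV[R]_d) :
    set (('rV[R]_d * 'rV[R]_d) ^nat) :=
  [set B : ('rV[R]_d * 'rV[R]_d) ^nat |
    (forall k i, ((B k).1 0 i <= (B k).2 0 i)%R) /\ E `<=` \bigcup_k box (B k)].

(* Lebesgue outer measure on R^d for d > 0; when d = 0 every cover has infinite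
   total volume. *)
Definition lebesgue_outer (E : set 'rV[R]_d) : \bar R :=
  ereal_inf [set \sum_(k <oo) (box_volume (B k))%:E | B in box_cover E].

Definition cone (E : set 'rV[R]_d) : set 'rV[R]_d :=
  [set x | exists t y, [/\ (0 < t <= 1)%R, E y & x = t *: y]].

(* Polar coordinates: since the Lebesgue measure of R^d disintegrates as
   t^(d-1) dt dsigma, the surface measure of a subset of the sphere is d times
   the volume of the truncated cone over it.  The surface measure is seen as a
   measure on R^d carried by the sphere. *)
Definition surface_outer (E : set 'rV[R]_d) : \bar R :=
  d%:R%:E * lebesgue_outer (cone (E `&` sphere)).

Lemma box_volume_ge0 (p : 'rV[R]_d * 'rV[R]_d) :
  (forall i, p.1 0 i <= p.2 0 i)%R ->
  (0 <= box_volume p)%R.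
Proof. by move=> h; apply: prodr_ge0 => i _; rewrite subr_ge0. Qed.

Lemma lebesgue_outer_ge0 E : 0 <= lebesgue_outer E.
Proof.
apply: le_ereal_inf_tmp => _ [B [B0 _] <-].
by apply: nneseries_ge0 => k _ _; rewrite lee_fin box_volume_ge0.
Qed.

Lemma le_lebesgue_outer : {homo lebesgue_outer : A B / A `<=` B >-> A <= B}.
Proof.
move=> A B AB; apply/ereal_inf_le_tmp => x [C [C0 BC] <-].
by exists C => //; split => //; exact: subset_trans BC.
Qed.

Lemma lebesgue_outer_sigma_subadditive : sigma_subadditive lebesgue_outer.
Proof.
move=> A; have [[i ioo]|] := pselect (exists i, lebesgue_outer (A i) = +oo).
  rewrite (eseries_pinfty _ _ ioo) ?leey// => n _.
  by rewrite -ltNye (lt_le_trans _ (lebesgue_outer_ge0 _)).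
rewrite -forallNE => Aoo.
suff add2e (e : {posnum R}) : lebesgue_outer (\bigcup_n A n) <=
    \sum_(i <oo) lebesgue_outer (A i) + e%:num%:E.
  by apply/lee_addgt0Pr => _/posnumP[].
rewrite (le_trans _ (epsilon_trick _ _ _))//; last first.
  by move=> n; exact: lebesgue_outer_ge0.
pose P n (B : ('rV[R]_d * 'rV[R]_d) ^nat) := box_cover (A n) B /\
  \sum_(k <oo) (box_volume (B k))%:E <=
    lebesgue_outer (A n) + (e%:num / (2 ^ n.+1)%:R)%:E.
have [G PG] : {G : (('rV[R]_d * 'rV[R]_d) ^nat) ^nat & forall n, P n (G n)}.
  apply: (@choice _ _ P) => n; rewrite /P /lebesgue_outer.
  set S := (X in ereal_inf X); move infS : (ereal_inf S) => iS.
  have en1 : (0 < e%:num / (2 ^ n.+1)%:R)%R by [].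
  have Sfin : ereal_inf S \is a fin_num.
    rewrite ge0_fin_numE; last exact: lebesgue_outer_ge0.
    by rewrite ltey; apply/eqP; exact: Aoo.
  have [_ [B AB <-] Bx] := lb_ereal_inf_adherent en1 Sfin.
  by exists B; split => //; rewrite -infS; exact/ltW.
pose v (x : nat * nat) : \bar R := (box_volume (G x.1 x.2))%:E.
have v_ge0 x : 0 <= v x.
  by rewrite lee_fin box_volume_ge0// => i; exact: (PG x.1).1.1.
apply: (@le_trans _ _ (\esum_(i in setT) v i)).
  apply: ereal_inf_lbound => /=.
  have /card_esym/ppcard_eqP[f] := card_nat2.
  exists (fun k => G (f k).1 (f k).2).
    split => [k i|]; first exact: (PG (f k).1).1.1.
    move=> t [i _ Ait]; have [j _ Bijt] := (PG i).1.2 _ Ait.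
    by exists (f^-1%FUN (i, j)) => //=; rewrite invK ?inE.
  rewrite -(esum_pred_image v f xpredT) ?[fun=> _]set_true//.
  by rewrite image_eq.
rewrite (_ : esum _ _ = \sum_(i <oo) \sum_(j <oo) v (i, j)); last first.
  rewrite nneseries_esumT; last first.
    by move=> n; apply: nneseries_ge0 => *; exact: v_ge0.
  rewrite (eq_esum (b := fun i => \esum_(j in setT) v (i, j))); last first.
    by move=> i _; rewrite nneseries_esumT.
  rewrite esum_esum//; congr (esum _ _).
  by apply/seteqP; split => // -[].
apply: lee_nneseries => [n _ _|n _]; last exact: (PG n).2.
by apply: nneseries_ge0 => *; exact: v_ge0.
Qed.

Lemma cone0 : cone set0 = set0.
Proof. by apply/seteqP; split => // x [t [y []]]. Qed.

Lemma surface_outer0 : surface_outer set0 = 0.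
Proof.
rewrite /surface_outer set0I cone0.
have [d0|d0] := posnP d; first by rewrite {1}d0 mul0e.
suff -> : lebesgue_outer set0 = 0 by rewrite mule0.
apply/eqP; rewrite eq_le lebesgue_outer_ge0 andbT.
apply: ereal_inf_lbound => /=; exists (fun=> (0, 0)%R).
  by split => // k i; rewrite lexx.
rewrite eseries0// => k _ _; rewrite /box_volume (bigD1 (Ordinal d0))//=.
by rewrite subrr mul0r.
Qed.

Lemma surface_outer_ge0 E : 0 <= surface_outer E.
Proof. by rewrite mule_ge0 ?lee_fin// lebesgue_outer_ge0. Qed.

Lemma le_surface_outer : {homo surface_outer : A B / A `<=` B >-> A <= B}.
Proof.
move=> A B AB; rewrite lee_wpmul2l ?lee_fin//; apply: le_lebesgue_outer.
by move=> x [t [y [t01 [Ay Sy] ->]]]; exists t, y; split => //; split; auto.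
Qed.

Lemma surface_outer_sigma_subadditive : sigma_subadditive surface_outer.
Proof.
move=> F; rewrite /surface_outer nneseriesZl//; last first.
  by move=> i _; exact: lebesgue_outer_ge0.
rewrite lee_wpmul2l ?lee_fin//.
apply: le_trans (lebesgue_outer_sigma_subadditive _).
apply: le_lebesgue_outer => x [t [y [t01 [[n _ Fny] Sy] ->]]].
by exists n => //; exists t, y.
Qed.

HB.instance Definition _ := isOuterMeasure.Build R 'rV[R]_d surface_outer
  surface_outer0 surface_outer_ge0 le_surface_outer
  surface_outer_sigma_subadditive.

End surface_measure.

(* 'rV[R]_d with the sigma-algebra of the sets whose trace on the sphere is
   Lebesgue measurable (including the non-Borel ones). *)
Notation sphere_space R d := (caratheodory_type (@surface_outer R d)).

Definition surface_measure {R : realType} {d : nat} :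
  set (sphere_space R d) -> \bar R := @surface_outer R d.

HB.instance Definition _ (R : realType) (d : nat) :=
  isMeasure.Build _ (sphere_space R d) R surface_measure
    (@caratheodory_measure0 R 'rV[R]_d surface_outer)
    (@caratheodory_measure_ge0 R 'rV[R]_d surface_outer)
    (@caratheodory_measure_sigma_additive R 'rV[R]_d surface_outer).

Section weights.
Context {R : realType} {d : nat}.
Implicit Types (w : sphere_space R d -> R) (E : set (sphere_space R d)).

Definition weight w :=
  (forall x, sphere x -> 0 <= w x) /\
  (@surface_measure R d).-integrable sphere (EFin \o w).

Definition weight_mass w E : \bar R :=
  (\int[@surface_measure R d]_(x in E) (w x)%:E)%E.

Definition sphere_partition N (P : 'I_N -> set (sphere_space R d)) :=
  [/\ forall j, measurable (P j),
      trivIset [set: 'I_N] P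
    & \bigcup_j P j = sphere].

End weights.

(* Main.v *)
(* One may take C = 8, whatever the weight.  Starting from any point, choose
   greedily centers x_0, x_1, ... at mutual distance greater than 2r, each new
   one within 3r of an earlier one, its parent: if the caps of radius 2r around
   the centers do not cover the sphere, walking along a geodesic to x_0 by steps
   of length r finds an uncovered point within r of a covered one.  The caps of
   radius r are disjoint and have mass at least 1/N, so this stops.  Split the
   sphere into cells, the i-th one containing the cap of radius r around x_i and
   contained in the cap of radius 2r.  From the last cell to the first, cut each
   cell into pieces of mass 1/N and leave to its parent a remainder of mass less
   than 1/N taken inside the cap of radius r; at x_0 nothing remains.  The pieces
   lie in caps of radius 4r.  Sets can be cut into arbitrary masses because
   w d sigma has no atoms. *)

Require Import Defs.
From HB Require Import structures.
From mathcomp Require Import all_boot all_order all_algebra.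
From mathcomp Require Import all_classical all_reals all_analysis.
From mathcomp Require Import measurable_realfun ring lra zify.

Set Implicit Arguments.
Unset Strict Implicit.
Unset Printing Implicit Defensive.
Import Order.TTheory GRing.Theory Num.Theory.
Import numFieldNormedType.Exports.
Local Open Scope classical_set_scope.
Local Open Scope ring_scope.

(** * Measurability for the surface measure *)

Section euclidean_lemmas.
Context {R : realType} {d : nat}.
Implicit Types x y z : 'rV[R]_d.

Lemma dotpC x y : dotp x y = dotp y x.
Proof. by apply: eq_bigr => i _; rewrite mulrC. Qed.

Lemma dotpDl x y z : dotp (x + y) z = dotp x z + dotp y z.
Proof. by rewrite -big_split; apply: eq_bigr => i _; rewrite mxE mulrDl. Qed.

Lemma dotpZl a x y : dotp (a *: x) y = a * dotp x y.
Proof. by rewrite mulr_sumr; apply: eq_bigr => i _; rewrite mxE mulrA. Qed.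

Lemma dotpDr x y z : dotp x (y + z) = dotp x y + dotp x z.
Proof. by rewrite !(dotpC x) dotpDl. Qed.

Lemma dotpZr a x y : dotp x (a *: y) = a * dotp x y.
Proof. by rewrite !(dotpC x) dotpZl. Qed.

Lemma dotp_ge0 x : 0 <= dotp x x.
Proof. by apply: sumr_ge0 => i _; rewrite -expr2 sqr_ge0. Qed.

Lemma sphereE x : sphere x <-> dotp x x = 1.
Proof.
rewrite /sphere /enorm /=; split=> [e|->]; last by rewrite sqrtr1.
by rewrite -(sqr_sqrtr (dotp_ge0 x)) e expr1n.
Qed.

Lemma enormZ t x : 0 <= t -> enorm (t *: x) = t * enorm x.
Proof.
move=> t0; rewrite /enorm dotpZl dotpZr mulrA -expr2.
by rewrite sqrtrM ?sqr_ge0// sqrtr_sqr ger0_norm.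
Qed.

Lemma sphere_coord_le1 x i : sphere x -> `|x 0 i| <= 1.
Proof.
move=> /sphereE x1; rewrite -(@ler_pXn2r _ 2)// ?nnegrE// expr1n.
rewrite real_normK ?num_real// -x1 /dotp (bigD1 i)//= -expr2 lerDl.
by apply: sumr_ge0 => j _; rewrite -expr2 sqr_ge0.
Qed.

End euclidean_lemmas.

Lemma measurable_fun_gtP (disp : measure_display) (T : measurableType disp)
    (R : realType) (f : T -> R) :
  (forall r, measurable [set x | r < f x]) -> measurable_fun setT f.
Proof.
move=> mf mT; apply: (measurability _ (RGenOInfty.measurableE R)) => //.
move=> _ [_ [r ->] <-]; rewrite preimage_itvoy; exact: measurableI.
Qed.

Lemma measurable_lt_fun (disp : measure_display) (T : measurableType disp)
    (R : realType) (f g : T -> R) : measurable_fun setT f ->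
  measurable_fun setT g -> measurable [set x | f x < g x].
Proof.
move=> mf mg; have := measurable_fun_ltr mf mg measurableT (Y := [set true]).
by rewrite setTI preimage_true; exact.
Qed.

Lemma measurable_le_fun (disp : measure_display) (T : measurableType disp)
    (R : realType) (f g : T -> R) : measurable_fun setT f ->
  measurable_fun setT g -> measurable [set x | f x <= g x].
Proof.
move=> mf mg; have := measurable_fun_ler mf mg measurableT (Y := [set true]).
by rewrite setTI preimage_true; exact.
Qed.

(** * Cutting boxes by coordinate hyperplanes *)

Section box_cut.
Context {R : realType} {d : nat}.
Implicit Types (p : 'rV[R]_d * 'rV[R]_d) (i : 'I_d) (c : R).

(** The height [c] is moved into the [i]-th side of the box, so that both halves keep ordered
    corners; one of them is degenerate when the hyperplane misses the box. *)
Definition clamp p i c := Num.max (p.1 0 i) (Num.min (p.2 0 i) c).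

Definition box_below p i c : 'rV[R]_d * 'rV[R]_d :=
  (p.1, \row_j if j == i then clamp p i c else p.2 0 j).

Definition box_above p i c : 'rV[R]_d * 'rV[R]_d :=
  (\row_j if j == i then clamp p i c else p.1 0 j, p.2).

Lemma box_belowP p i c : (forall j, p.1 0 j <= p.2 0 j) ->
  (forall j, (box_below p i c).1 0 j <= (box_below p i c).2 0 j) /\
  box p `&` [set x | x 0 i <= c] `<=` box (box_below p i c).
Proof.
move=> hp; split=> [j|x [px /= xc] j] /=; rewrite mxE.
  by case: ifPn => [/eqP ->|_ //]; rewrite /clamp le_max lexx.
have := px j; case: ifPn => [/eqP -> /andP[-> xp2]|//] /=.
by rewrite /clamp le_max le_min xp2 xc orbT.
Qed.

Lemma box_aboveP p i c : (forall j, p.1 0 j <= p.2 0 j) ->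
  (forall j, (box_above p i c).1 0 j <= (box_above p i c).2 0 j) /\
  box p `&` [set x | c < x 0 i] `<=` box (box_above p i c).
Proof.
move=> hp; split=> [j|x [px /= xc] j] /=; rewrite mxE.
  by case: ifPn => [/eqP ->|_ //]; rewrite /clamp ge_max hp ge_min lexx.
have := px j; case: ifPn => [/eqP -> /andP[xp1 ->]|//] /=.
by rewrite andbT /clamp ge_max xp1 ge_min (ltW xc) orbT.
Qed.

Lemma box_volume_cut p i c :
  box_volume (box_below p i c) + box_volume (box_above p i c) = box_volume p.
Proof.
rewrite /box_volume (bigD1 i)//= [X in _ + X](bigD1 i)//= [RHS](bigD1 i)//=.
rewrite !mxE eqxx.
under eq_bigr => j ji do rewrite mxE (negbTE ji).
under [X in _ + _ * X]eq_bigr => j ji do rewrite mxE (negbTE ji).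
by rewrite -mulrDl; congr (_ * _); ring.
Qed.

(** The hyperplane cuts each box of a cover into two boxes whose volumes add up to its own, so every
    cover of [X] yields covers of both parts with the same total volume. This is the nontrivial half
    of Caratheodory's criterion for half-spaces. *)
Lemma lebesgue_outer_cut i c (X : set 'rV[R]_d) :
  (lebesgue_outer (X `&` [set x | (c < x 0 i)%R]) +
   lebesgue_outer (X `&` [set x | (x 0 i <= c)%R]) <= lebesgue_outer X)%E.
Proof.
apply: le_ereal_inf_tmp => _ [B [B0 XB] <-].
pose lo k := box_below (B k) i c; pose hi k := box_above (B k) i c.
have -> : (\sum_(k <oo) (box_volume (B k))%:E =
    \sum_(k <oo) (box_volume (hi k))%:E +
    \sum_(k <oo) (box_volume (lo k))%:E)%E.
  rewrite -nneseriesD; first last.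
  - move=> k _ _; rewrite lee_fin box_volume_ge0//.
    exact: (box_belowP _ _ (B0 k)).1.
  - move=> k _ _; rewrite lee_fin box_volume_ge0//.
    exact: (box_aboveP _ _ (B0 k)).1.
  by apply: eq_eseriesr => k _; rewrite -EFinD addrC box_volume_cut.
apply: leeD; apply: ereal_inf_lbound.
- exists hi => //; split=> [k j|x [/XB[k _ Bx] xc]].
    exact: (box_aboveP _ _ (B0 k)).1.
  by exists k => //; apply: (box_aboveP _ _ (B0 k)).2.
- exists lo => //; split=> [k j|x [/XB[k _ Bx] xc]].
    exact: (box_belowP _ _ (B0 k)).1.
  by exists k => //; apply: (box_belowP _ _ (B0 k)).2.
Qed.

End box_cut.

Section lebesgue_space.
Local Open Scope ereal_scope.
Context {R : realType} {d : nat}.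

(* The factor d makes this an outer measure also when d = 0. *)
Definition volume_outer (E : set 'rV[R]_d) : \bar R :=
  d%:R%:E * lebesgue_outer E.

Lemma volume_outer0 : volume_outer set0 = 0.
Proof. by rewrite -[RHS](@surface_outer0 R d) /surface_outer set0I cone0. Qed.

Lemma volume_outer_ge0 E : 0 <= volume_outer E.
Proof. by rewrite mule_ge0 ?lee_fin// lebesgue_outer_ge0. Qed.

Lemma le_volume_outer : {homo volume_outer : A B / A `<=` B >-> A <= B}.
Proof. by move=> A B AB; rewrite lee_wpmul2l ?lee_fin// le_lebesgue_outer. Qed.

Lemma volume_outer_sigma_subadditive : sigma_subadditive volume_outer.
Proof.
move=> F; rewrite /volume_outer nneseriesZl//; last first.
  by move=> i _; exact: lebesgue_outer_ge0.
by rewrite lee_wpmul2l ?lee_fin// lebesgue_outer_sigma_subadditive.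
Qed.

HB.instance Definition _ := isOuterMeasure.Build R 'rV[R]_d volume_outer
  volume_outer0 volume_outer_ge0 le_volume_outer
  volume_outer_sigma_subadditive.

End lebesgue_space.

Notation lebesgue_space R d := (caratheodory_type (@volume_outer R d)).

(** * Transfer of measurability from the space to the sphere *)

Section borel_functions.
Context {R : realType} {d : nat}.

Lemma measurable_coord_lebesgue (i : 'I_d) :
  measurable_fun setT (fun x : lebesgue_space R d => x 0 i).
Proof.
apply: measurable_fun_gtP => c; apply: le_caratheodory_measurable => X.
have -> : ~` [set x : 'rV[R]_d | c < x 0 i] = [set x | x 0 i <= c].
  by apply/seteqP; split=> x /=; rewrite leNgt => /negP.
rewrite -muleDr; [|by []|by rewrite ge0_adde_def ?inE ?lebesgue_outer_ge0].
by rewrite lee_wpmul2l ?lee_fin// lebesgue_outer_cut.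
Qed.

Lemma measurable_enorm_lebesgue :
  measurable_fun setT (@enorm R d : lebesgue_space R d -> R).
Proof.
apply: (measurableT_comp (f := @Num.sqrt R)).
  apply: continuous_measurable_fun; exact: sqrt_continuous.
apply: measurable_sum => i.
by apply: measurable_funM; exact: measurable_coord_lebesgue.
Qed.

(** The infinite cone, without its apex, over the trace of [A] on the sphere. *)
Definition radial (A : set 'rV[R]_d) : set 'rV[R]_d :=
  [set x | 0 < enorm x /\ A ((enorm x)^-1 *: x)].

Lemma cone_radial (X A : set 'rV[R]_d) : X `<=` sphere ->
  cone (X `&` A) = cone X `&` radial A.
Proof.
move=> XS; have h t y : (0 < t <= 1) -> X y ->
    enorm (t *: y) = t /\ t^-1 *: (t *: y) = y.
  move=> /andP[t0 _] /XS y1; rewrite enormZ ?ltW// y1 mulr1.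
  by rewrite scalerA mulVf ?scale1r// gt_eqF.
apply/seteqP; split=> x.
  move=> [t [y [t01 [Xy Ay] ->]]]; have [e1 e2] := h t y t01 Xy.
  split; first by exists t, y.
  by rewrite /radial/= e1 e2; split=> //; have /andP[] := t01.
move=> [[t [y [t01 Xy ->]]]]; have [e1 e2] := h t y t01 Xy.
by rewrite /radial/= e1 e2 => -[t0 Ay]; exists t, y.
Qed.

(** The surface outer measure of [X] is the volume outer measure of the truncated cone over its
    trace on the sphere, and cutting [X] by [A] amounts to cutting that cone by [radial A].
    Caratheodory's identity for [radial A], tested on cones, is therefore the one for [A]. *)
Lemma measurable_radial (A : set 'rV[R]_d) :
  measurable (radial A : set (lebesgue_space R d)) ->
  measurable (A : set (sphere_space R d)).
Proof.
move=> mA; apply: le_caratheodory_measurable => X.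
pose Y := X `&` sphere; have YS : Y `<=` sphere by exact: subIsetr.
have h1 : cone (X `&` A `&` sphere) = cone Y `&` radial A.
  by rewrite -cone_radial// setIAC.
have h2 : cone (X `&` ~` A `&` sphere) = cone Y `&` ~` radial A.
  rewrite -setIAC cone_radial//; apply/seteqP; split=> x [Yx].
    by move=> [_ nA]; split=> // -[].
  move=> nrA; split=> //; split.
    move: Yx => [t [y [/andP[t0 _] Yy ->]]].
    by rewrite enormZ ?ltW// (YS _ Yy) mulr1.
  move=> Ax; apply: nrA; split=> //.
  move: Yx => [t [y [/andP[t0 _] Yy ->]]].
  by rewrite enormZ ?ltW// (YS _ Yy) mulr1.
have : volume_outer (cone Y) =
  (volume_outer (cone Y `&` radial A) +
   volume_outer (cone Y `&` ~` radial A))%E.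
  exact: mA.
have : volume_outer (cone Y) = surface_outer X by [].
move=> -> e; rewrite le_eqVlt; apply/orP; left; apply/eqP/esym.
by move: e; rewrite -h1 -h2.
Qed.

Lemma measurable_coord (i : 'I_d) :
  measurable_fun setT (fun x : sphere_space R d => x 0 i).
Proof.
apply: measurable_fun_gtP => c; apply: measurable_radial.
(* Clearing the denominator [enorm x] leaves a comparison of two functions already known to be
   measurable on the whole space. *)
have -> : radial [set x | c < x 0 i] =
    [set x | 0 < enorm x] `&` [set x | c * enorm x < x 0 i].
  apply/seteqP; split=> x /= [x0 h]; split=> //=; move: h; rewrite /= mxE.
    by rewrite [_^-1 * _]mulrC ltr_pdivlMr.
  by rewrite [_^-1 * _]mulrC ltr_pdivlMr.
have m0 : measurable_fun setT (fun x : lebesgue_space R d => c * enorm x).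
  by apply: measurable_funM => //; exact: measurable_enorm_lebesgue.
apply: measurableI.
- by apply: measurable_lt_fun => //; exact: measurable_enorm_lebesgue.
- by apply: measurable_lt_fun => //; exact: measurable_coord_lebesgue.
Qed.

Lemma measurable_dotp (y : 'rV[R]_d) :
  measurable_fun setT (fun x : sphere_space R d => dotp y x).
Proof.
apply: measurable_sum => i.
by apply: measurable_funM => //; exact: measurable_coord.
Qed.

Lemma measurable_sphere : measurable (sphere : set (sphere_space R d)).
Proof.
have -> : sphere =
    [set x : 'rV[R]_d | dotp x x <= 1] `&` [set x | 1 <= dotp x x].
  apply/seteqP; split=> [x /sphereE /= ->//|x /= [h1 h2]].
  by apply/sphereE/eqP; rewrite eq_le h1.
have m : measurable_fun setT (fun x : sphere_space R d => dotp x x).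
  apply: measurable_sum => i.
  by apply: measurable_funM; exact: measurable_coord.
by apply: measurableI; apply: measurable_le_fun.
Qed.

End borel_functions.

(** * Points of the sphere are null sets *)

Section null_points.
Context {R : realType} {d : nat}.

(** The cone over a point is a segment. It is covered by N + 1 boxes of sides at most 1/N, where N =
    n + 1; as d is at least 2, each has volume at most 1/N^2, and (N + 1)/N^2 is at most 2/N. *)
Lemma lebesgue_outer_segment (y : 'rV[R]_d) n : (2 <= d)%N ->
  (forall i, `|y 0 i| <= 1) ->
  (lebesgue_outer (cone [set y]) <= (2 * n.+1%:R^-1)%:E)%E.
Proof.
move=> d2 y1; set N := n.+1; have N0 : 0 < N%:R :> R by [].
pose e k i : R := y 0 i * (k%:R / N%:R).
(* The index k = N serves the endpoint t = 1, whose truncation is N. The minima and maxima account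
   for negative coordinates of [y], and the later boxes are reduced to the origin. *)
pose B k : 'rV[R]_d * 'rV[R]_d := if (k <= N)%N then
  (\row_i Num.min (e k i) (e k.+1 i), \row_i Num.max (e k i) (e k.+1 i))
  else (0, 0).
have B0 k i : (B k).1 0 i <= (B k).2 0 i.
  rewrite /B; case: ifP => _ /=; rewrite ?lexx// !mxE.
  by rewrite ge_min le_max lexx.
have d0 : (0 < d)%N by rewrite ltnW.
have volB k : box_volume (B k) <= if (k <= N)%N then N%:R^-1 ^+ 2 else 0.
  rewrite /B; case: ifP => _; last first.
    by rewrite /box_volume (bigD1 (Ordinal d0))//= subrr mul0r.
  apply: (@le_trans _ _ (N%:R^-1 ^+ d)).
    rewrite /box_volume -[in leRHS](card_ord d) -prodr_const.
    apply: ler_prod => i _ /=; rewrite !mxE.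
    have -> : Num.max (e k i) (e k.+1 i) - Num.min (e k i) (e k.+1 i) =
        `|y 0 i| * N%:R^-1.
      have ek : e k.+1 i = e k i + y 0 i * N%:R^-1.
        by rewrite /e -natr1; ring.
      have N10 : 0 < N%:R^-1 :> R by rewrite invr_gt0.
      rewrite ek; have [yi|yi] := leP 0 (y 0 i).
        have h : 0 <= y 0 i * N%:R^-1 by rewrite mulr_ge0// ltW.
        by rewrite max_r ?min_l ?lerDl// addrAC subrr add0r ger0_norm.
      have h : y 0 i * N%:R^-1 <= 0 by rewrite pmulr_lle0// ltW.
      by rewrite max_l ?min_r ?gerDl// opprD addNKr ltr0_norm// mulNr.
    by rewrite mulr_ge0//= ler_piMl.
  by rewrite ler_wiXn2l// invf_le1// ler1n.
apply: (@le_trans _ _ (\sum_(k <oo) (box_volume (B k))%:E)%E).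
  apply: ereal_inf_lbound; exists B => //; split=> // x.
  move=> [t [_ [/andP[t0 t1] -> ->]]].
  have tN0 : 0 <= t * N%:R by rewrite mulr_ge0// ltW.
  pose k := Num.truncn (t * N%:R).
  have /andP[kt tk] : k%:R <= t * N%:R < k.+1%:R by exact: truncn_itv.
  have kN : (k <= N)%N.
    by rewrite -(ler_nat R) (le_trans kt)// ler_piMl.
  exists k => // i; rewrite /B kN /= !mxE mulrC.
  have h1 : k%:R / N%:R <= t by rewrite ler_pdivrMr.
  have h2 : t <= k.+1%:R / N%:R by rewrite ler_pdivlMr// ltW.
  rewrite ge_min le_max /e; have [yi|yi] := leP 0 (y 0 i).
    by apply/andP; split; apply/orP; [left|right]; apply: ler_wpM2l.
  by apply/andP; split; apply/orP; [right|left]; rewrite ler_nM2l.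
rewrite (nneseries_split 0 N.+1); last first.
  by move=> k _; rewrite lee_fin box_volume_ge0.
rewrite [X in (_ + X <= _)%E]eseries0 ?adde0; last first.
  move=> k + _; rewrite add0n => Nk; congr (_%:E); apply/eqP.
  rewrite eq_le box_volume_ge0// andbT.
  by have := volB k; rewrite leqNgt Nk.
rewrite add0n big_mkord sumEFin lee_fin.
apply: (@le_trans _ _ (\sum_(k < N.+1) N%:R^-1 ^+ 2)).
  by apply: ler_sum => k _; have := volB k; rewrite -ltnS ltn_ord.
rewrite sumr_const card_ord -[_ *+ N.+1]mulr_natl expr2 mulrA.
apply: ler_wpM2r; first by rewrite invr_ge0.
by rewrite ler_pdivrMr// -natrM ler_nat /N; lia.
Qed.

Lemma surface_outer_point (y : 'rV[R]_d) : (2 <= d)%N -> sphere y ->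
  surface_outer [set y] = 0%E.
Proof.
move=> d2 Sy; rewrite /surface_outer.
have -> : [set y] `&` sphere = [set y] by apply/setIidPl => x ->.
suff -> : lebesgue_outer (cone [set y]) = 0%E by rewrite mule0.
apply/eqP; rewrite eq_le lebesgue_outer_ge0 andbT.
apply/lee_addgt0Pr => e e0; rewrite add0e.
have [|n] := @ltr_add_invr R 0 (e / 2); first by rewrite divr_gt0.
rewrite add0r => ne.
have y1 i := sphere_coord_le1 i Sy.
apply: le_trans (lebesgue_outer_segment n d2 y1) _.
by rewrite lee_fin mulrC -ler_pdivlMr// ltW.
Qed.

Lemma measurable_point (y : 'rV[R]_d) : (2 <= d)%N -> sphere y ->
  measurable ([set y] : set (sphere_space R d)).
Proof.
move=> d2 Sy; apply: le_caratheodory_measurable => X.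
have h0 : (surface_outer (X `&` [set y]) <= 0)%E.
  rewrite -[leRHS](surface_outer_point d2 Sy); apply: le_surface_outer.
  exact: subIsetr.
rewrite -[leRHS]add0e; apply: leeD => //.
by apply: le_surface_outer; exact: subIsetl.
Qed.

End null_points.

(** * Geodesic distance *)

Section geodesic_distance.
Context {R : realType} {d : nat}.
Implicit Types x y z : 'rV[R]_d.

Lemma dotp_eq0 x : dotp x x = 0 -> x = 0.
Proof.
move=> x0; apply/rowP => i; rewrite mxE; apply/eqP.
have h j : true -> 0 <= x 0 j * x 0 j by rewrite -expr2 sqr_ge0.
by have /eqP := psumr_eq0P h x0 (erefl _ : xpredT i); rewrite mulf_eq0 orbb.
Qed.

Lemma dotp_cauchy_schwarz x y : dotp x y ^+ 2 <= dotp x x * dotp y y.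
Proof.
have [y0|y0] := eqVneq (dotp y y) 0.
  suff -> : y = 0.
    have z0 z : dotp z 0 = 0 by rewrite -(scale0r 0) dotpZr mul0r.
    by rewrite !z0 expr0n mulr0.
  exact: dotp_eq0.
have yy : 0 < dotp y y by rewrite lt_def y0 dotp_ge0.
have := dotp_ge0 (dotp y y *: x + (- dotp x y) *: y).
rewrite !(dotpDl, dotpDr, dotpZl, dotpZr) (dotpC y x).
set a := dotp x x; set b := dotp x y; set c := dotp y y in yy *.
move=> h; have : 0 <= c * (a * c - b ^+ 2).
  by rewrite (le_trans h)// le_eqVlt; apply/orP; left; apply/eqP; ring.
by rewrite pmulr_rge0// subr_ge0.
Qed.

Lemma dotp_sphere_itv x y : sphere x -> sphere y -> -1 <= dotp x y <= 1.
Proof.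
move=> /sphereE x1 /sphereE y1; have := dotp_cauchy_schwarz x y.
rewrite x1 y1 mulr1 -ler_norml => h.
by rewrite -(@ler_pXn2r _ 2)// ?nnegrE// expr1n real_normK ?num_real.
Qed.

Lemma cos_geodist x y : sphere x -> sphere y -> cos (geodist x y) = dotp x y.
Proof. by move=> Sx Sy; have [] := acos_def (dotp_sphere_itv Sx Sy). Qed.

Lemma geodist_itv x y : sphere x -> sphere y -> 0 <= geodist x y <= pi.
Proof. by move=> Sx Sy; have [] := acos_def (dotp_sphere_itv Sx Sy). Qed.

Lemma geodistC x y : geodist x y = geodist y x.
Proof. by rewrite /geodist dotpC. Qed.

Lemma geodist_le x y (r : R) : sphere x -> sphere y -> 0 <= r <= pi ->
  (geodist x y <= r) = (cos r <= dotp x y).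
Proof.
move=> Sx Sy r0; rewrite -(cos_geodist Sx Sy).
by rewrite !leNgt ltr_cos// in_itv/= ?geodist_itv.
Qed.

Lemma geodistxx x : sphere x -> geodist x x = 0.
Proof. by rewrite /geodist => /sphereE ->; rewrite acos1. Qed.

(** If a + b exceeds pi there is nothing to prove. Otherwise the claim is that cos (a + b) is at
    most the product of [x] and [z]. It follows from the Cauchy-Schwarz inequality for the
    components of [x] and [z] orthogonal to [y], whose norms are sin a and sin b. *)
Lemma geodist_triangle x y z : sphere x -> sphere y -> sphere z ->
  geodist x z <= geodist x y + geodist y z.
Proof.
move=> Sx Sy Sz; set a := geodist x y; set b := geodist y z.
have /andP[a0 api] := geodist_itv Sx Sy.
have /andP[b0 bpi] := geodist_itv Sy Sz.
have [abpi|/ltW piab] := leP (a + b) pi; last first.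
  by apply: le_trans piab; have /andP[] := geodist_itv Sx Sz.
rewrite geodist_le//; last by rewrite addr_ge0.
rewrite cosD (cos_geodist Sx Sy) (cos_geodist Sy Sz).
have sa : 0 <= sin a by rewrite sin_ge0_pi// a0.
have sb : 0 <= sin b by rewrite sin_ge0_pi// b0.
have := dotp_cauchy_schwarz (x + (- dotp x y) *: y) (z + (- dotp y z) *: y).
rewrite !(dotpDl, dotpDr, dotpZl, dotpZr) (dotpC y x) (dotpC z y).
rewrite (sphereE x).1// (sphereE y).1// (sphereE z).1//.
have ea : sin a ^+ 2 = 1 - dotp x y ^+ 2 by rewrite sin2cos2 cos_geodist.
have eb : sin b ^+ 2 = 1 - dotp y z ^+ 2 by rewrite sin2cos2 cos_geodist.
move: ea eb; set p := dotp x y; set q := dotp y z; set w := dotp x z.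
move=> ea eb h.
have {}h : (w - p * q) ^+ 2 <= (sin a * sin b) ^+ 2.
  rewrite exprMn ea eb; apply: le_trans (le_trans _ h) _.
    by rewrite le_eqVlt; apply/orP; left; apply/eqP; ring.
  by rewrite le_eqVlt; apply/orP; left; apply/eqP; ring.
rewrite lerBlDr -lerBlDl -opprB lerNl.
have : `|w - p * q| <= sin a * sin b.
  by rewrite -(@ler_pXn2r _ 2)// ?nnegrE ?mulr_ge0// real_normK ?num_real.
by rewrite ler_norml => /andP[].
Qed.

Lemma measurable_cap x (r : R) : sphere x -> 0 <= r ->
  measurable (cap x r : set (sphere_space R d)).
Proof.
(* The cosine is monotone only up to pi; a cap of larger radius is the whole sphere. *)
move=> Sx r0; have [rpi|/ltW pir] := leP r pi.
  have -> : cap x r = sphere `&` [set y | cos r <= dotp x y].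
    by apply/seteqP; split=> y /= [Sy h]; split=> //=; move: h;
      rewrite geodist_le// r0.
  apply: measurableI; first exact: measurable_sphere.
  by apply: measurable_le_fun => //; exact: measurable_dotp.
have -> : cap x r = sphere; last exact: measurable_sphere.
apply/seteqP; split=> y /=; first by case.
move=> Sy; split=> //.
by rewrite (le_trans _ pir)//; have /andP[] := geodist_itv Sx Sy.
Qed.

Lemma dotp_delta (i : 'I_d) x : dotp (delta_mx 0 i) x = x 0 i.
Proof.
rewrite /dotp (bigD1 i)//= mxE !eqxx mul1r big1 ?addr0// => j ji.
by rewrite mxE (negbTE ji) andbF mul0r.
Qed.

Lemma exists_orthogonal x : (2 <= d)%N -> sphere x ->
  exists2 v, sphere v & dotp x v = 0.
Proof.
move=> d2 Sx; pose i0 := Ordinal (ltnW d2); pose i1 := Ordinal d2.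
have i10 : (i1 == i0) = false by [].
suff [u u0 xu] : exists2 u : 'rV[R]_d, u != 0 & dotp x u = 0.
  have uu : 0 < dotp u u.
    rewrite lt_def dotp_ge0 andbT; apply: contra u0 => /eqP uu0.
    exact/eqP/dotp_eq0.
  have u1 : 0 < enorm u by rewrite sqrtr_gt0.
  exists ((enorm u)^-1 *: u); last by rewrite dotpZr xu mulr0.
  by rewrite /sphere/= enormZ ?invr_ge0 ?ltW// mulVf// gt_eqF.
(* The first two coordinates of [x] are turned by a right angle; if both vanish, the first basis
   vector is orthogonal to [x]. *)
pose u : 'rV[R]_d := x 0 i1 *: delta_mx 0 i0 + (- x 0 i0) *: delta_mx 0 i1.
have [u0|u0] := eqVneq u 0; last first.
  exists u => //; rewrite dotpDr !dotpZr !(dotpC x) !dotp_delta mulNr mulrC.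
  by rewrite subrr.
exists (delta_mx 0 i0).
  apply/eqP => /rowP/(_ i0); rewrite !mxE !eqxx /= => /eqP.
  by rewrite oner_eq0.
rewrite dotpC dotp_delta; have /rowP/(_ i1) := u0.
rewrite !mxE !eqxx i10 /= mulr0 add0r mulr1 => /eqP.
by rewrite oppr_eq0 => /eqP.
Qed.

(** The direction [v] is the normalized component of [y] orthogonal to [x]. This component vanishes
    when [y] is [x] or its antipode, and then any unit vector orthogonal to [x] will do. *)
Lemma geodesic_direction x y : (2 <= d)%N -> sphere x -> sphere y ->
  exists v, [/\ sphere v, dotp x v = 0 &
    y = cos (geodist x y) *: x + sin (geodist x y) *: v].
Proof.
move=> d2 Sx Sy; set a := geodist x y.
have xx : dotp x x = 1 by apply/sphereE.
have yy : dotp y y = 1 by apply/sphereE.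
have sa2 : sin a ^+ 2 = 1 - dotp x y ^+ 2 by rewrite sin2cos2 cos_geodist.
pose u := y + (- dotp x y) *: x.
have uu : dotp u u = sin a ^+ 2.
  rewrite sa2 !(dotpDl, dotpDr, dotpZl, dotpZr) xx yy (dotpC y x); ring.
have ux : dotp x u = 0.
  by rewrite !(dotpDl, dotpDr, dotpZl, dotpZr) xx; ring.
have [s0|s0] := eqVneq (sin a) 0.
  have [v Sv xv] := exists_orthogonal d2 Sx.
  exists v; split=> //; rewrite s0 scale0r addr0 cos_geodist//.
  have : u = 0 by apply: dotp_eq0; rewrite uu s0 expr0n.
  by rewrite /u scaleNr => /subr0_eq.
exists ((sin a)^-1 *: u); split.
- by apply/sphereE; rewrite dotpZl dotpZr uu; field.
- by rewrite dotpZr ux mulr0.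
- by rewrite scalerA mulfV// scale1r cos_geodist// /u scaleNr addrC subrK.
Qed.

(** The great circle g(t) = cos t x + sin t v passes through [x] at 0 and through [y] at a, and the
    product of g(t) and g(u) is cos (t - u), so t is arc length. The point sought is g(a - s). *)
Lemma geodesic_point x y (s : R) : (2 <= d)%N -> sphere x -> sphere y ->
  0 <= s <= geodist x y ->
  exists z, [/\ sphere z, geodist x z = geodist x y - s & geodist z y = s].
Proof.
move=> d2 Sx Sy /andP[s0 sa]; set a := geodist x y in sa *.
have /andP[a0 api] := geodist_itv Sx Sy.
have [v [Sv xv ey]] := geodesic_direction d2 Sx Sy.
have xx : dotp x x = 1 by apply/sphereE.
have vv : dotp v v = 1 by apply/sphereE.
pose g t := cos t *: x + sin t *: v.
have gg t u : dotp (g t) (g u) = cos (t - u).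
  rewrite !(dotpDl, dotpDr, dotpZl, dotpZr) (dotpC v x) xv xx vv cosB; ring.
exists (g (a - s)); split.
- by apply/sphereE; rewrite gg subrr cos0.
- rewrite /geodist -{1}(_ : g 0 = x); last first.
    by rewrite /g cos0 sin0 scale1r scale0r addr0.
  rewrite gg sub0r cosN cosK// in_itv/= subr_ge0 sa/=.
  by rewrite (le_trans _ api)// gerBl.
- rewrite {1}/geodist ey -/a -/(g a) gg addrAC subrr sub0r cosN cosK//.
  by rewrite in_itv/= s0 (le_trans sa).
Qed.

End geodesic_distance.

(** * Cutting sets of prescribed mass *)

Section nonatomic.
Context {disp : measure_display} {T : measurableType disp} {R : realType}.
Variable mu : {measure set T -> \bar R}.

(** The level is the supremum of those whose strict sublevel set has mass at most [t]; continuity of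
    the measure from below and from above gives the two bounds. *)
Lemma measure_slice (f : T -> R) (a b : R) (A : set T) (t : \bar R) :
  measurable A -> (mu A < +oo)%E -> measurable_fun setT f ->
  (forall x, A x -> a <= f x <= b) -> (0 <= t <= mu A)%E ->
  exists s, (mu (A `&` [set x | (f x < s)%R]) <= t)%E /\
            (t <= mu (A `&` [set x | (f x <= s)%R]))%E.
Proof.
move=> mA Afin mf fab /andP[t0 tA].
have mlt s : measurable (A `&` [set x | f x < s]).
  apply: measurableI => //; rewrite -[X in measurable X]setTI.
  rewrite -preimage_itvNyo; exact: mf.
have mle s : measurable (A `&` [set x | f x <= s]).
  apply: measurableI => //; rewrite -[X in measurable X]setTI.
  rewrite -preimage_itvNyc; exact: mf.
(* If [t] is the whole mass, the set of levels used below is unbounded; the level [b] settles this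
   case. *)
have [tmA|] := leP (mu A) t.
  have <- : mu A = t by apply/eqP; rewrite eq_le tmA.
  exists b; split; first by rewrite le_measure ?inE.
  rewrite le_measure ?inE// => x Ax; split=> //.
  by have /andP[] := fab x Ax.
move=> {tA} tA.
pose S := [set s | (mu (A `&` [set x | (f x < s)%R]) <= t)%E].
have Sa : S a.
  rewrite /S/= (_ : _ `&` _ = set0) ?measure0//.
  apply/seteqP; split=> // x [Ax /=].
  by have /andP[/le_gtF ->] := fab x Ax.
have Sb : ubound S b.
  move=> s Ss; rewrite leNgt; apply/negP => bs.
  move: Ss; rewrite /S/= (_ : _ `&` _ = A); last first.
    apply/seteqP; split=> [x []//|x Ax]; split=> //=.
    by rewrite (le_lt_trans _ bs)//; have /andP[] := fab x Ax.
  by rewrite leNgt tA.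
have supS : has_sup S by split; [exists a|exists b].
have S_lt s : s < sup S -> S s.
  move=> /(sup_gt supS.1)[u Su su].
  apply: le_trans Su; rewrite le_measure ?inE//; apply: setIS => x /= fx.
  exact: lt_trans su.
exists (sup S); split.
- have -> : A `&` [set x | f x < sup S] =
      \bigcup_n (A `&` [set x | f x < sup S - n.+1%:R^-1]).
    apply/seteqP; split=> x /=.
      move=> [Ax fS]; have [n hn] := ltr_add_invr fS.
      by exists n => //; split=> //=; rewrite ltrBrDr.
    move=> [n _ [Ax /= fx]]; split=> //; apply: lt_trans fx _.
    by rewrite ltrBlDr ltrDl invr_gt0.
  have := @nondecreasing_cvg_mu _ _ _ mu
    (fun n => A `&` [set x | f x < sup S - n.+1%:R^-1]) (fun=> mlt _).
  move=> /(_ (bigcupT_measurable _ (fun=> mlt _))) h.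
  apply: (cvge_le _ (h _)).
    apply: nearW => n /=; apply: S_lt.
    by rewrite ltrBlDr ltrDl invr_gt0.
  move=> n m nm; apply/subsetPset; apply: setIS => x /= /lt_le_trans; apply.
  by rewrite lerD2l lerN2 lef_pV2 ?posrE// ler_nat.
- have eA : A `&` [set x | f x <= sup S] =
      \bigcap_n (A `&` [set x | f x < sup S + n.+1%:R^-1]).
    apply/seteqP; split=> x /=.
      move=> [Ax fS] n _; split=> //=.
      by rewrite (le_lt_trans fS)// ltrDl invr_gt0.
    move=> h; split; first by have [] := h 0%N I.
    rewrite leNgt; apply/negP => fS; have [n hn] := ltr_add_invr fS.
    by have [_ /=] := h n I; rewrite ltNge ltW.
  have mcap : measurable (\bigcap_n (A `&` [set x | f x < sup S + n.+1%:R^-1])).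
    by rewrite -eA.
  rewrite eA.
  have h := @nonincreasing_cvg_mu _ _ _ mu
    (fun n => A `&` [set x | f x < sup S + n.+1%:R^-1]) _ (fun=> mlt _) mcap _.
  apply: (cvge_ge _ (h _ _)).
  + apply: nearW => n /=; rewrite leNgt; apply/negP => /ltW Sn.
    have : S (sup S + n.+1%:R^-1) by [].
    by move=> /(ub_le_sup supS.2); rewrite leNgt ltrDl invr_gt0 ltr0n.
  + by rewrite (le_lt_trans _ Afin)// le_measure ?inE.
  + move=> n m nm; apply/subsetPset; apply: setIS => x /= /lt_le_trans; apply.
    by rewrite lerD2l lef_pV2 ?posrE// ler_nat.
Qed.

(* Lexicographic cut: the excess of a cut by the first function is concentrated
   on one of its level sets, which is in turn cut by the next functions. *)
Lemma measure_split (I : eqType) (f : I -> T -> R) (a b : R) (s : seq I)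
    (A : set T) (t : R) :
  (forall i, measurable_fun setT (f i)) -> measurable A -> (mu A < +oo)%E ->
  (forall i x, A x -> a <= f i x <= b) ->
  (forall B, measurable B -> B `<=` A ->
     (forall i x y, i \in s -> B x -> B y -> f i x = f i y) -> mu B = 0%E) ->
  0 <= t -> (t%:E <= mu A)%E ->
  exists B, [/\ measurable B, B `<=` A & mu B = t%:E].
Proof.
move=> mf; elim: s A t => [|i s ih] A t mA Afin fab A0 t0 tA.
  (* With no function left the last hypothesis applies to [A] itself, so [A] is null and t = 0. *)
  exists set0; split=> //; rewrite measure0.
  by apply/eqP; rewrite eq_le lee_fin t0 -(A0 A).
have [|c [cl cu]] := measure_slice (t := t%:E) mA Afin (mf i) (fab i).
  by rewrite lee_fin t0.
set A1 := A `&` [set x | f i x < c] in cl.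
set A2 := A `&` [set x | f i x <= c] in cu.
have mA1 : measurable A1.
  apply: measurableI => //; rewrite -[X in measurable X]setTI.
  rewrite -preimage_itvNyo; exact: mf.
have mA2 : measurable A2.
  apply: measurableI => //; rewrite -[X in measurable X]setTI.
  rewrite -preimage_itvNyc; exact: mf.
have A12 : A1 `<=` A2 by apply: setIS => x; exact: ltW.
have lefin B : measurable B -> B `<=` A -> (mu B < +oo)%E.
  by move=> mB BA; rewrite (le_lt_trans _ Afin)// le_measure ?inE.
have A2fin := lefin _ mA2 (@subIsetl _ _ _).
have A1fin := lefin _ mA1 (@subIsetl _ _ _).
(* This is the part of [A] where [f i] equals [c]. A subset of it on which the functions of [s] are
   constant has [f i] constant as well, so the nullity hypothesis is inherited. *)
pose A3 := A2 `\` A1.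
have mA3 : measurable A3 by exact: measurableD.
have A3A : A3 `<=` A by move=> x [[]].
pose t1 := fine (mu A1).
have et1 : mu A1 = t1%:E by rewrite fineK// ge0_fin_numE.
have t1t : t1 <= t by rewrite -lee_fin -et1.
have [||||B [mB BA3 eB]] := ih A3 (t - t1) mA3 (lefin _ mA3 A3A).
- by move=> j x /A3A; exact: fab.
- move=> B mB BA3 hB; apply: A0 => //; first exact: subset_trans A3A.
  move=> j x y; rewrite inE => /orP[/eqP ->|]; last exact: hB.
  have e z : B z -> f i z = c.
    move=> /BA3[[Az /= fz] nz]; apply/eqP; rewrite eq_le fz/= leNgt.
    by apply/negP => fc; apply: nz.
  by move=> /e -> /e ->.
- by rewrite subr_ge0.
- have -> : mu A3 = (mu A2 - mu A1)%E.
    by rewrite measureD// (setIidr A12).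
  by rewrite EFinB et1 leeB.
exists (A1 `|` B); split.
- exact: measurableU.
- by rewrite subUset; split; [exact: subIsetl|exact: subset_trans A3A].
- have A1B : A1 `&` B = set0.
    by apply/seteqP; split=> // x [A1x /BA3[]].
  transitivity (mu A1 + mu B)%E; first exact: measureU.
  by rewrite et1 eB -EFinD addrC subrK.
Qed.

End nonatomic.

(** * Partitions into pieces of equal mass *)

Section mass_partition.
Context {disp : measure_display} {T : measurableType disp} {R : realType}.
Variable mu : {measure set T -> \bar R}.
Implicit Types (A B : set T) (Z : set (set T)) (m t : R) (q : nat).

(** Indexing by natural numbers below [q] lets families be concatenated by a shift; [Z] records
    where a piece may lie. *)
Definition mass_partition Z m q A :=
  exists P : nat -> set T,
    [/\ trivIset `I_q P, \bigcup_(i in `I_q) P i = A &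
      forall i, (i < q)%N -> [/\ measurable (P i), mu (P i) = m%:E & Z (P i)]].

(** The intermediate value property, which Sierpinski's theorem gives for nonatomic finite
    measures. *)
Definition divisible :=
  forall A t, measurable A -> 0 <= t -> (t%:E <= mu A)%E ->
    exists B, [/\ measurable B, B `<=` A & mu B = t%:E].

Lemma sub_mass_partition Z Z' m q A : Z `<=` Z' ->
  mass_partition Z m q A -> mass_partition Z' m q A.
Proof.
move=> ZZ' [P [tP uP hP]]; exists P; split=> // i iq.
by have [mP eP /ZZ'] := hP i iq.
Qed.

Lemma mass_partition1 Z m A : measurable A -> mu A = m%:E -> Z A ->
  mass_partition Z m 1 A.
Proof.
move=> mA eA ZA; exists (fun=> A); split=> //.
- by move=> i j /=; rewrite !ltnS !leqn0 => /eqP -> /eqP ->.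
- by rewrite bigcup_const//; exists 0%N.
Qed.

Lemma mass_partitionU Z m q q' A B : A `&` B = set0 ->
  mass_partition Z m q A -> mass_partition Z m q' B ->
  mass_partition Z m (q + q') (A `|` B).
Proof.
move=> AB0 [P [tP uP hP]] [Q [tQ uQ hQ]].
have PA i x : (i < q)%N -> P i x -> A x by move=> iq Px; rewrite -uP; exists i.
have QB i x : (i < q')%N -> Q i x -> B x by move=> iq Px; rewrite -uQ; exists i.
have AB x : A x -> B x -> False by move=> Ax Bx; rewrite -[False]/(set0 x) -AB0.
pose F i := if (i < q)%N then P i else Q (i - q)%N.
have lt_sub i : (i < q + q')%N -> (i < q)%N = false -> (i - q < q')%N.
  by move=> iqq /negbT; rewrite -leqNgt => qi; rewrite ltn_subLR.
exists F; split.
- move=> i j /= iq jq [x []]; rewrite /F.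
  case: ifPn => iq'; case: ifPn => jq'.
  + by move=> Pi Pj; apply: tP => //; exists x.
  + move=> /(PA _ _ iq') Ax /(QB _ _ (lt_sub _ jq (negbTE jq'))) Bx.
    by case: (AB x).
  + move=> /(QB _ _ (lt_sub _ iq (negbTE iq'))) Bx /(PA _ _ jq') Ax.
    by case: (AB x).
  + move=> Qi Qj; have : (i - q = j - q)%N.
      apply: tQ; rewrite /=; last by exists x.
      - exact: lt_sub (negbTE iq').
      - exact: lt_sub (negbTE jq').
    by move: iq' jq'; rewrite -!leqNgt => h1 h2 h; rewrite -(subnK h1) h subnK.
- apply/seteqP; split=> x /=.
  + move=> [i /= iq]; rewrite /F; case: ifPn => iq'.
      by move=> /(PA _ _ iq'); left.
    by move=> /(QB _ _ (lt_sub _ iq (negbTE iq'))); right.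
  + case; rewrite -?uP -?uQ => -[i /= iq Fx].
      by exists i; rewrite /= ?/F ?iq//; exact: ltn_addr.
    by exists (q + i)%N; rewrite /= ?ltn_add2l// /F ltnNge leq_addr/= addKn.
- move=> i iq; rewrite /F; case: ifPn => iq'; first exact: hP.
  exact/hQ/lt_sub/negbTE.
Qed.

(** Pieces of mass [m] are cut off one by one until the rest is the last piece. At least one piece
    is required, since a null set need not be empty. *)
Lemma equal_mass_partition m q A : divisible -> measurable A -> 0 <= m ->
  (0 < q)%N -> mu A = (q%:R * m)%:E -> mass_partition [set B | B `<=` A] m q A.
Proof.
move=> dmu + m0; case: q => // q + _; elim: q A => [|q ih] A mA eA.
  by apply: mass_partition1 => //; rewrite eA mul1r.
have [|B [mB BA eB]] := dmu A m mA m0.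
  by rewrite eA lee_fin ler_peMl// ler1n.
have eAB : mu (A `\` B) = (q.+1%:R * m)%:E.
  have Aoo : (mu A < +oo)%E by rewrite eA ltry.
  rewrite measureD//.
  rewrite (setIidr BA); transitivity (mu A - mu B)%E => //.
  by rewrite eA eB -EFinB -[in LHS]natr1 mulrDl mul1r addrK.
have -> : A = (A `\` B) `|` B by rewrite setUC setDUK.
rewrite -addn1; apply: mass_partitionU.
- by rewrite setDE -setIA setICl setI0.
- apply: sub_mass_partition (ih _ (measurableD mA mB) eAB).
  by move=> C /= CAB x /CAB; left.
- by apply: mass_partition1 => // x; right.
Qed.

(* The i-th cell consists of its core V i and of E i, and its pieces must stay
   in the zone S i.  The remainder handed over to the parent is taken in the
   core, so that no point moves up the tree by more than one step. *)
Lemma tree_mass_partition m (p : nat -> nat) (S : nat -> set T) n k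
    (V E : nat -> set T) :
  divisible -> 0 < m ->
  (forall i, (i <= n)%N -> [/\ measurable (V i), measurable (E i),
     (m%:E <= mu (V i))%E, V i `<=` S i & E i `<=` S i]) ->
  (forall i, (0 < i <= n)%N -> (p i < i)%N /\ V i `<=` S (p i)) ->
  (forall i, (i <= n)%N -> V i `&` E i = set0) ->
  trivIset `I_n.+1 (fun i => V i `|` E i) ->
  mu (\bigcup_(i in `I_n.+1) (V i `|` E i)) = (k%:R * m)%:E ->
  mass_partition [set B | exists2 j, (j <= n)%N & B `<=` S j] m k
    (\bigcup_(i in `I_n.+1) (V i `|` E i)).
Proof.
(* The last cell, which has no child left, is removed: this lowers [k] by the number of its pieces
   and enlarges [E] at its parent, while cores, zones and parents stay fixed. *)
move=> dmu m0; elim: n k E => [|n ih] k E hVE hp VE0 tVE.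
  have [mV mE Vm VS ES] := hVE 0%N isT.
  have -> : \bigcup_(i in `I_1) (V i `|` E i) = V 0%N `|` E 0%N.
    apply/seteqP; split=> x; last by exists 0%N.
    by move=> [i /=]; rewrite ltnS leqn0 => /eqP ->.
  move=> eW; have mW : measurable (V 0%N `|` E 0%N) by exact: measurableU.
  have k0 : (0 < k)%N.
    rewrite lt0n; apply/negP => /eqP k0; move: eW; rewrite k0 mul0r => eW.
    have : (m%:E <= 0%:E)%E.
      by rewrite -eW (le_trans Vm)// le_measure ?inE//; exact: subsetUl.
    by rewrite lee_fin leNgt m0.
  apply: sub_mass_partition (equal_mass_partition dmu mW (ltW m0) k0 eW).
  move=> B /= BW; exists 0%N => //.
  by apply: subset_trans BW _; rewrite subUset.
set U := \bigcup_(i in `I_n.+1) (V i `|` E i).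
set W := V n.+1 `|` E n.+1.
have UW : \bigcup_(i in `I_n.+2) (V i `|` E i) = U `|` W.
  by rewrite IIS bigcup_setU bigcup_set1.
have UW0 : U `&` W = set0.
  apply/seteqP; split=> // x [[i /= il Wi] Wn].
  have := tVE i n.+1 (leqW il) (ltnSn _) (ex_intro _ x (conj Wi Wn)).
  by move=> e; move: il; rewrite e ltnn.
rewrite UW => eUW.
have [mV mE Vm VS ES] := hVE _ (leqnn n.+1).
have mW : measurable W by exact: measurableU.
have mU : measurable U.
  apply: bigcup_measurable => i /= il.
  by have [mVi mEi _ _ _] := hVE i (ltnW il); exact: measurableU.
have finUW B : measurable B -> B `<=` U `|` W -> mu B \is a fin_num.
  move=> mB BUW; rewrite ge0_fin_numE//.
  apply: (@le_lt_trans _ _ (mu (U `|` W))); last by rewrite eUW ltry.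
  by rewrite le_measure ?inE//; exact: measurableU.
have finW : mu W \is a fin_num by apply: finUW => //; exact: subsetUr.
pose M := fine (mu W); have eW : mu W = M%:E by rewrite fineK.
have mM : m <= M.
  rewrite -lee_fin -eW (le_trans Vm)// le_measure ?inE//; exact: subsetUl.
have Mm0 : 0 <= M / m by rewrite divr_ge0 ?(ltW m0)// (le_trans (ltW m0)).
pose q := Num.truncn (M / m).
have /andP[qM Mq] : q%:R <= M / m < q.+1%:R by exact: truncn_itv.
have q0 : (0 < q)%N by rewrite truncn_gt0 ler_pdivlMr// mul1r.
(* The remainder left by q = floor (M / m) pieces is at most [m], hence at most the mass of the
   core, so it can be taken there as the set [D]. *)
pose rho := M - q%:R * m.
have rho0 : 0 <= rho by rewrite subr_ge0 -ler_pdivlMr.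
have rhom : rho <= m.
  by rewrite lerBlDl -[X in _ + X]mul1r -mulrDl natr1 ltW// -ltr_pdivrMr.
have [|D [mD DV eD]] := dmu _ _ mV rho0.
  by rewrite (le_trans _ Vm)// lee_fin.
have DW : D `<=` W by apply: subset_trans DV _; exact: subsetUl.
have eWD : mu (W `\` D) = (q%:R * m)%:E.
  have Woo : (mu W < +oo)%E by rewrite -ge0_fin_numE.
  rewrite measureD//.
  rewrite (setIidr DW); transitivity (mu W - mu D)%E => //.
  by rewrite eW eD -EFinB; congr (_%:E); rewrite /rho; ring.
have [pn VSp] := hp n.+1 (leqnn _).
(* [D] joins the part [E] of the parent, not its core; it stays in the parent's zone because the
   core of the child lies there. *)
pose E' i := if i == p n.+1 then E i `|` D else E i.
have DVi i : (i <= n)%N -> (V i `|` E i) `&` D = set0.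
  move=> il; apply/seteqP; split=> // x [WI /DW Wx].
  by rewrite -UW0; split=> //; exists i.
have EE' i : E i `<=` E' i by rewrite /E'; case: ifP => _ x Ex //; left.
have E'D i : E' i `<=` E i `|` D by rewrite /E'; case: ifP => _ x Ex //; left.
have UD : \bigcup_(i in `I_n.+1) (V i `|` E' i) = U `|` D.
  apply/seteqP; split=> x.
    move=> [i /= il [Vi|/E'D[Ei|Dx]]]; [left|left|by right]; exists i => //.
      by left.
    by right.
  case=> [[i /= il [Vi|/EE' Ei]]|Dx].
  - by exists i => //; left.
  - by exists i => //; right.
  - by exists (p n.+1) => //; right; rewrite /E' eqxx; right.
have UDWD0 : (U `|` D) `&` (W `\` D) = set0.
  apply/seteqP; split=> // x [[Ux|Dx] [Wx nDx]] //.
  by rewrite -UW0.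
have UDWD : (U `|` D) `|` (W `\` D) = U `|` W by rewrite -setUA setDUK.
have mUD : measurable (U `|` D) by exact: measurableU.
have eUD : mu (U `|` D) = (k%:R * m - q%:R * m)%:E.
  have : (mu (U `|` D) + mu (W `\` D) = (k%:R * m)%:E)%E.
    by rewrite -eUW -UDWD; apply/esym/measureU => //; exact: measurableD.
  have /fineK <- : mu (U `|` D) \is a fin_num.
    by apply: finUW => //; exact: setUS.
  by rewrite eWD -EFinD => -[<-]; rewrite addrK.
have qk : (q <= k)%N.
  have : (0 <= mu (U `|` D))%E by [].
  by rewrite eUD lee_fin subr_ge0 ler_pM2r// ler_nat.
rewrite -UDWD -(subnK qk).
apply: mass_partitionU => //; last first.
  apply: sub_mass_partition
    (equal_mass_partition dmu (measurableD mW mD) (ltW m0) q0 eWD).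
  move=> B /= BW; exists n.+1 => //; apply: (subset_trans BW).
  by apply: subset_trans (@subDsetl _ _ _) _; rewrite /W subUset.
rewrite -UD.
apply: (@sub_mass_partition [set B | exists2 j, (j <= n)%N & B `<=` S j]).
  by move=> B [j jn BS]; exists j => //; exact: leqW.
apply: ih.
- move=> i il; have [mVi mEi Vmi VSi ESi] := hVE _ (leqW il).
  split=> //; rewrite /E'; case: ifPn => // /eqP ip.
    exact: measurableU.
  by rewrite subUset; split=> //; rewrite ip; exact: subset_trans VSp.
- by move=> i /andP[i0 il]; apply: hp; rewrite i0 leqW.
- move=> i il; apply/seteqP; split=> // x [Vx /E'D[Ex|Dx]].
    by rewrite -(VE0 i (leqW il)).
  by rewrite -(DVi i il); split=> //; left.
(* A point of [D] belongs only to the enlarged cell of the parent; any other point lies in the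
   original cells, which are disjoint. *)
- move=> i j /= il jl [x [Wi Wj]].
  have [Dx|nDx] := pselect (D x).
    have h l : (l <= n)%N -> (V l `|` E' l) x -> l = p n.+1.
      move=> ln; rewrite /E'; case: ifPn => [/eqP //|_] Wl.
      by have : set0 x by rewrite -(DVi l ln).
    by rewrite (h i)// (h j).
  apply: tVE; [exact: leqW|exact: leqW|exists x; split].
    by case: Wi => [|/E'D[|//]]; [left|right].
  by case: Wj => [|/E'D[|//]]; [left|right].
- by rewrite UD eUD natrB// mulrBl.
Qed.

End mass_partition.

(** * Measures given by a density *)

Section density.
Context {disp : measure_display} {T : measurableType disp} {R : realType}.
Variables (mu : {measure set T -> \bar R}) (D : set T) (f : T -> \bar R).
Hypotheses (mD : measurable D) (mf : measurable_fun D f)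
  (f0 : forall x, D x -> (0 <= f x)%E).

(** Intersecting with [D] gives a measure on the whole space although [f] is controlled on [D] only,
    just as a weight is controlled on the sphere only. *)
Definition density (E : set T) : \bar R := (\int[mu]_(x in E `&` D) f x)%E.

Lemma exists_density : exists nu : {measure set T -> \bar R},
  forall E, nu E = density E.
Proof.
have nu0 : density set0 = 0%E by rewrite /density set0I integral_set0.
have nu_ge0 E : (0 <= density E)%E by apply: integral_ge0 => x [_ /f0].
have nu_sigma : semi_sigma_additive density.
  move=> F mF tF mUF; rewrite /density setI_bigcupl ge0_integral_bigcup//.
  - apply: is_cvg_nneseries => n _ _; exact: nu_ge0.
  - by move=> k; exact: measurableI.
  - by apply: measurable_funS mf => // x [k _ []].
  - by move=> x [k _ [_ /f0]].
  - exact: trivIset_setIr.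
pose M := isMeasure.Build _ T R density nu0 nu_ge0 nu_sigma.
pose nu : {measure set T -> \bar R} := HB.pack density M.
by exists nu.
Qed.

End density.

(** * Cells on the sphere *)

Section spherical_cells.
Context {R : realType} {d : nat}.
Hypothesis d2 : (2 <= d)%N.
Implicit Types (x : nat -> 'rV[R]_d) (y z : 'rV[R]_d) (p : nat -> nat) (r : R).

(** Walking from [y] towards [o] along a geodesic by steps of length [r], one enters [C] at some
    step, at the latest on reaching [o]. The induction is on a bound [k] for the number of steps,
    initially chosen with k r at least pi. *)
Lemma boundary_step (C : set 'rV[R]_d) o y r : 0 < r -> sphere o -> C o ->
  sphere y -> ~ C y ->
  exists z z', [/\ sphere z, ~ C z, sphere z', C z' & geodist z' z <= r].
Proof.
move=> r0 So Co.
have [k] : exists k, pi <= k%:R * r.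
  exists (Num.truncn (pi / r)).+1; rewrite -ler_pdivrMr// ltW//.
  by rewrite truncnS_gt.
move=> pik Sy nCy.
have : geodist o y <= k%:R * r.
  by rewrite (le_trans _ pik)//; have /andP[] := geodist_itv So Sy.
elim: k {pik} y Sy nCy => [|k ih] y Sy nCy oy.
  by exists y, o; split=> //; rewrite (le_trans oy)// mul0r ltW.
have [yr|/ltW ry] := leP (geodist o y) r; first by exists y, o.
have [|z [Sz oz zy]] := @geodesic_point R d o y r d2 So Sy.
  by rewrite ltW.
have [Cz|nCz] := pselect (C z); first by exists y, z; rewrite zy.
by apply: ih Sz nCz _; rewrite oz lerBlDr -[X in _ + X]mul1r -mulrDl natr1.
Qed.

(** [n] is the last index, so there are n + 1 centers, with root 0. The bound 2r makes the caps of
    radius [r] disjoint; the bound 3r puts such a cap inside the cap of radius 4r around the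
    parent. *)
Definition separated_tree r n x p :=
  [/\ forall i, (i <= n)%N -> sphere (x i),
      forall i j, (i < j <= n)%N -> 2 * r < geodist (x i) (x j) &
      forall i, (0 < i <= n)%N ->
        (p i < i)%N /\ geodist (x (p i)) (x i) <= 3 * r].

Definition covering r n x :=
  forall y, sphere y -> exists2 i, (i <= n)%N & geodist (x i) y <= 2 * r.

(** With [C] the union of the caps of radius 2r, a boundary step gives an uncovered point within [r]
    of a point covered by some x_j: it is more than 2r away from every center and at most 3r away
    from its parent x_j. *)
Lemma separated_tree_extend r n x p : 0 < r -> separated_tree r n x p ->
  ~ covering r n x -> exists x' p', separated_tree r n.+1 x' p'.
Proof.
move=> r0 [Sx sepx px] ncov.
pose C := [set y | exists2 i, (i <= n)%N & geodist (x i) y <= 2 * r].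
have [y [Sy nCy]] : exists y, sphere y /\ ~ C y.
  apply: contrapT => h; apply: ncov => y Sy; apply: contrapT => nCy.
  by apply: h; exists y.
have So := Sx 0%N isT.
have Co : C (x 0%N) by exists 0%N => //; rewrite geodistxx// mulr_ge0// ltW.
have [z [z' [Sz nCz Sz' [j jn xj] z'z]]] := boundary_step r0 So Co Sy nCy.
exists (fun i => if (i <= n)%N then x i else z).
exists (fun i => if (i <= n)%N then p i else j).
have hn : (n.+1 <= n)%N = false by rewrite ltnn.
split=> [i|i k /andP[ik]|i /andP[i0]];
  rewrite leq_eqVlt ltnS => /orP[/eqP e|kn]; subst.
- by rewrite hn.
- by rewrite kn; exact: Sx.
- rewrite hn; have il : (i <= n)%N by [].
  by rewrite il ltNge; apply/negP => h; apply: nCz; exists i.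
- rewrite kn (leq_trans (ltnW ik) kn); apply: sepx; exact/andP.
- rewrite hn jn ltnS; split=> //.
  by rewrite (le_trans (geodist_triangle _ Sz' _))//; [exact: Sx|lra].
- have [pi_ ?] := px i (introT andP (conj i0 kn)).
  by rewrite kn (leq_trans (ltnW pi_) kn).
Qed.

Definition core r x i : set (sphere_space R d) := cap (x i) r.

(** All cores are removed, those of later centers included, so that every cell keeps its core whole;
    where the larger caps overlap, the smallest index wins. *)
Definition extra r n x i : set (sphere_space R d) :=
  cap (x i) (2 * r) `\` (\bigcup_(j in `I_n.+1) cap (x j) r `|`
                        \bigcup_(j in `I_i) cap (x j) (2 * r)).

Lemma le_cap y r (s : R) : r <= s -> cap y r `<=` cap y s.
Proof. by move=> rs z [Sz zr]; split=> //; exact: le_trans rs. Qed.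

Lemma cap_center y z r (s t : R) : sphere y -> sphere z ->
  geodist y z <= s -> r + s <= t -> cap z r `<=` cap y t.
Proof.
move=> Sy Sz yz rst u [Su zu]; split=> //.
rewrite (le_trans (geodist_triangle Sy Sz Su))// (le_trans _ rst)//.
by rewrite addrC lerD.
Qed.

Lemma geodist_cap y (z1 z2 : 'rV[R]_d) r :
  sphere y -> cap y r z1 -> cap y r z2 -> geodist z1 z2 <= 2 * r.
Proof.
move=> Sy [S1 h1] [S2 h2].
rewrite (le_trans (geodist_triangle S1 Sy S2))// geodistC mulr_natl mulr2n.
exact: lerD.
Qed.

Lemma geodiam_sub_cap y r (B : set 'rV[R]_d) : sphere y ->
  B `<=` cap y r -> (geodiam B <= (2 * r)%:E)%E.
Proof.
move=> Sy By; apply: ge_ereal_sup => _ [[a b] [/= /By ay /By yb] <-].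
by rewrite lee_fin; exact: geodist_cap Sy ay yb.
Qed.

Section cells.
Variables (r : R) (n : nat) (x : nat -> 'rV[R]_d) (p : nat -> nat).
Hypotheses (r0 : 0 < r) (tx : separated_tree r n x p).

Let Sx i : (i <= n)%N -> sphere (x i). Proof. by case: tx => + _ _; exact. Qed.

Lemma disjoint_core i j y : (i <= n)%N -> (j <= n)%N ->
  core r x i y -> core r x j y -> i = j.
Proof.
move=> ilen jn [Sy iy] [_ jy].
have le2 : geodist (x i) (x j) <= 2 * r.
  apply: (@geodist_cap y); first exact: Sy.
    by split; [exact: Sx|rewrite geodistC].
  by split; [exact: Sx|rewrite geodistC].
have [_ sepx _] := tx.
case: (ltngtP i j) => // ij; exfalso.
  by have := sepx i j; rewrite ij jn ltNge le2 => /(_ isT).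
by have := sepx j i; rewrite ij ilen geodistC ltNge le2 => /(_ isT).
Qed.

Lemma disjoint_cells i j y : (i <= n)%N -> (j <= n)%N ->
  (core r x i `|` extra r n x i) y -> (core r x j `|` extra r n x j) y -> i = j.
Proof.
wlog ij : i j / (i <= j)%N.
  move=> h ilen jn iy jy; have [ij|/ltnW ji] := leqP i j; first exact: h.
  exact/esym/h.
move=> ilen jn [iy|[iy niy]] [jy|[jy njy]].
- exact: disjoint_core iy jy.
- by case: njy; left; exists i.
- by case: niy; left; exists j.
- move: ij; rewrite leq_eqVlt => /orP[/eqP //|ij].
  by case: njy; right; exists i.
Qed.

Lemma core_extra0 i : (i <= n)%N -> core r x i `&` extra r n x i = set0.
Proof.
move=> ilen; apply/seteqP; split=> // y [iy [_ niy]].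
by apply: niy; left; exists i.
Qed.

Lemma measurable_core i : (i <= n)%N -> measurable (core r x i).
Proof. by move=> ilen; apply: measurable_cap; [exact: Sx|exact: ltW]. Qed.

Lemma measurable_extra i : (i <= n)%N -> measurable (extra r n x i).
Proof.
move=> ilen; apply: measurableD.
  by apply: measurable_cap; [exact: Sx|rewrite mulr_ge0// ltW].
apply: measurableU; apply: bigcup_measurable => j /= jn.
  by apply: measurable_cap; [exact: Sx|exact: ltW].
apply: measurable_cap; last by rewrite mulr_ge0// ltW.
by apply: Sx; apply: leq_trans ilen; exact: ltnW.
Qed.

(** A point outside all cores falls in the cell of the least index whose cap of radius 2r contains
    it. *)
Lemma bigcup_cells : covering r n x ->
  \bigcup_(i in `I_n.+1) (core r x i `|` extra r n x i) = sphere.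
Proof.
move=> cov; apply/seteqP; split=> y.
  by move=> [i _ [[]//|[[]]]].
move=> Sy; have [i0 i0n yi0] := cov y Sy.
have [[j /= jn yj]|ncore] := pselect (exists2 j, (j <= n)%N & core r x j y).
  by exists j => //; left.
have ex : exists i, geodist (x i) y <= 2 * r by exists i0.
case: (ex_minnP ex) => i yi imin.
have ilen : (i <= n)%N by rewrite (leq_trans _ i0n)// imin.
exists i => //; right; split=> // -[[j /= jn yj]|[j /= ji [_ yj]]].
  by apply: ncore; exists j.
by have := imin _ yj; rewrite leqNgt ji.
Qed.

End cells.

End spherical_cells.

(** If no separated tree covered the sphere, each could be extended, and the one-point tree at [o]
    would grow up to the forbidden index [N]. *)
Lemma exists_covering_tree (R : realType) (d N : nat) (r : R) (o : 'rV[R]_d) :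
  (2 <= d)%N -> 0 < r -> sphere o ->
  (forall (x : nat -> 'rV[R]_d) p, ~ separated_tree r N x p) ->
  exists n (x : nat -> 'rV[R]_d) p, separated_tree r n x p /\ covering r n x.
Proof.
move=> d2 r0 So noN; apply: contrapT => ncov.
suff [x [p /noN]] :
  exists (x : nat -> 'rV[R]_d) p, separated_tree r N x p by [].
elim: N {noN} => [|n [x [p tx]]].
  exists (fun=> o), (fun=> 0%N); split=> [i|i j /andP[ij]|i /andP[]] //.
    by rewrite leqn0 => /eqP j0; move: ij; rewrite j0.
  by rewrite leqn0 => + /eqP i0; rewrite i0.
apply: (separated_tree_extend d2 r0 tx) => cov.
by apply: ncov; exists n, x, p.
Qed.

(** The coordinates serve as cutting functions: a set on which all of them are constant has at most
    one point, hence is null. *)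
Lemma divisible_sphere_measure (R : realType) (d : nat)
    (nu : {measure set (sphere_space R d) -> \bar R}) :
  (nu sphere < +oo)%E -> (forall E, nu E = nu (E `&` sphere)) ->
  (forall y : 'rV[R]_d, sphere y -> nu [set y] = 0%E) -> divisible nu.
Proof.
move=> nufin nuS nu1 A t mA t0 tA.
have mS := @measurable_sphere R d.
have mAS : measurable (A `&` sphere) by exact: measurableI.
have fin : (nu (A `&` sphere) < +oo)%E.
  by rewrite (le_lt_trans _ nufin)// le_measure ?inE//; exact: subIsetr.
have [|||B [mB BA eB]] := @measure_split _ _ R nu 'I_d
  (fun i (x : sphere_space R d) => x 0 i) (-1) 1 (enum 'I_d) (A `&` sphere) t
  (@measurable_coord R d) mAS fin _ _ t0.
- by move=> i x [_ Sx]; rewrite -ler_norml; exact: sphere_coord_le1.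
- move=> B mB BA hB.
  have [->|/set0P[y By]] := eqVneq B set0; first exact: measure0.
  have -> : B = [set y].
    apply/seteqP; split=> [x Bx|_ ->//]; apply/rowP => i.
    by apply: hB; rewrite ?mem_enum.
  by apply: nu1; have [] := BA y By.
- by rewrite -nuS.
exists B; split=> //; apply: subset_trans BA _; exact: subIsetl.
Qed.

Unset Implicit Arguments.
Set Strict Implicit.
Set Printing Implicit Defensive.

Theorem corollary1p6 (R : realType) (d : nat) (hd : (2 <= d)%N)
    (w : sphere_space R d -> R) (hw : weight w)
    (hw1 : weight_mass w sphere = 1%E)
    (hcap : forall (x : 'rV[R]_d) (r : R), sphere x -> 0 < r ->
      (0 < weight_mass w (cap x r))%E) :
  exists C : R, 0 < C /\
    forall (r : R) (N : nat), 0 < r <= pi -> (0 < N)%N ->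
      (forall x : 'rV[R]_d, sphere x ->
        ((N%:R^-1)%:E <= weight_mass w (cap x r))%E) ->
      exists P : 'I_N -> set (sphere_space R d),
        sphere_partition P /\
        forall j : 'I_N,
          weight_mass w (P j) = (N%:R^-1)%:E /\
          (geodiam (P j) <= (C * r)%:E)%E.
Proof.
have mS := @measurable_sphere R d.
have [w0 iw] := hw.
have mw : measurable_fun (sphere : set (sphere_space R d)) (EFin \o w).
  exact: measurable_int iw.
have [|nu nuE] := exists_density (@surface_measure R d) mS mw.
  by move=> x Sx; rewrite lee_fin w0.
have wE E : E `<=` sphere -> nu E = weight_mass w E.
  by move=> ES; rewrite nuE /density (setIidl ES).
have nu_sphere : nu sphere = 1%E by rewrite wE.
have dnu : divisible nu.
  apply: divisible_sphere_measure; first by rewrite nu_sphere ltry.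
    by move=> E; rewrite !nuE /density -setIA setIid.
  move=> y Sy; have yS : [set y] `<=` sphere by move=> _ ->.
  rewrite wE//; apply: null_set_integral; last exact: surface_outer_point.
    exact: measurable_point.
  exact: measurable_funS mw.
(* The pieces lie in caps of radius 4r, whose diameter is at most 8r. *)
exists 8; split=> //= r N /andP[r0 rpi] N0 hN.
pose m : R := N%:R^-1; have m0 : 0 < m by rewrite invr_gt0 ltr0n.
have [c Sc] : exists c : 'rV[R]_d, sphere c.
  exists (delta_mx 0 (Ordinal (ltnW hd))); apply/sphereE.
  by rewrite dotp_delta mxE !eqxx.
have core_ge (x : nat -> 'rV[R]_d) (p : nat -> nat) n i :
    separated_tree r n x p -> (i <= n)%N -> (m%:E <= nu (core r x i))%E.
  move=> [Sx _ _] ilen; rewrite wE; last by move=> ? [].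
  exact/hN/Sx.
(* Last index [N] means N + 1 disjoint cores of mass at least 1/N each, more than the total mass
   1. *)
have noN (x : nat -> 'rV[R]_d) (p : nat -> nat) : ~ separated_tree r N x p.
  move=> tx; have [Sx _ _] := tx.
  have mU : measurable (\big[setU/set0]_(i < N.+1) core r x i).
    apply: bigsetU_measurable => i _.
    exact: (measurable_core r0 tx (ltn_ord i)).
  have eU : nu (\big[setU/set0]_(i < N.+1) core r x i) =
      (\sum_(i < N.+1) nu (core r x i))%E.
    apply: measure_semi_additive_ord_I => // [i iN|i j iN jN [y [iy jy]]].
      exact: (measurable_core r0 tx iN).
    exact: (disjoint_core tx iN jN iy jy).
  have : (nu (\big[setU/set0]_(i < N.+1) core r x i) <= 1)%E.
    rewrite -nu_sphere le_measure ?inE// -bigcup_mkord.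
    by move=> y [i _ []].
  rewrite eU; apply/negP; rewrite -ltNge.
  apply: (@lt_le_trans _ _ (\sum_(i < N.+1) m%:E)%E).
    rewrite sumEFin lte_fin sumr_const card_ord mulrSr -mulr_natr.
    by rewrite mulVf ?ltrDl// pnatr_eq0 -lt0n.
  by apply: lee_sum => i _; exact: (core_ge _ _ _ _ tx (ltn_ord i)).
have [n [x [p [tx cov]]]] := exists_covering_tree hd r0 Sc noN.
have [Sx _ px] := tx.
(* The zone of a cell is the cap of radius 4r around its center: it contains the cell, which lies
   within 2r, and the cores of its children, since 3r + r = 4r. The total mass 1 is [N] times [m],
   so there are exactly [N] pieces. *)
have [P [tP uP hP]] : mass_partition nu
    [set B | exists2 i, (i <= n)%N & B `<=` cap (x i) (4 * r)] m N sphere.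
  rewrite -(bigcup_cells cov); apply: (tree_mass_partition (p := p)) => //.
  - move=> i ilen; split; [exact: (measurable_core r0 tx ilen)|
      exact: (measurable_extra r0 tx ilen)|exact: (core_ge _ _ _ _ tx ilen)| |].
      by apply: le_cap; lra.
    by apply: subset_trans (@subDsetl _ _ _) _; apply: le_cap; lra.
  - move=> i i0n; have [pi_ xpi] := px i i0n; split=> //.
    have /andP[_ ilen] := i0n.
    apply: (cap_center _ _ xpi); [apply: Sx|exact: Sx|lra].
    exact: leq_trans (ltnW pi_) ilen.
  - by move=> i ilen; exact: core_extra0.
  - move=> i j /= ilen jn [y [iy jy]].
    exact: (disjoint_cells tx ilen jn iy jy).
  - by rewrite (bigcup_cells cov) nu_sphere mulfV// pnatr_eq0 -lt0n.
exists (fun j => P j); split.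
- split=> [j|i j _ _ [y [iy jy]]|].
  + by have [] := hP j (ltn_ord j).
  + by apply/val_inj/tP; rewrite /=; [exact: ltn_ord|exact: ltn_ord|exists y].
  + rewrite -uP; apply/seteqP; split=> y.
      by move=> [j _ Pj]; exists j => /=.
    by move=> [j /= jN Pj]; exists (Ordinal jN).
move=> j; have [mP eP [i ilen Pi]] := hP j (ltn_ord j); split.
  by rewrite -wE// => y /Pi[].
have -> : 8 * r = 2 * (4 * r) by ring.
exact: geodiam_sub_cap (Sx i ilen) Pi.
Qed.
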